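(* Let $n \geq 1$ and $0 \leq k \leq n-1$. Identify a monomial $x_1^{a_1}\cdots x_n^{a_n}$ with its exponent vector $(a_1,\dots,a_n)$. Then the set of standard monomials of the ideal $M_n^{(k)}$ equals the set $\mathcal{P}(\mathbf{u}_{n,k})$ of $\mathbf{u}_{n,k}$-parking functions, where \[\mathbf{u}_{n,k} = (\underbrace{n-k, n-k, \dots, n-k}_{n-k \text{ times}}, n-k+1, n-k+2, \dots, n).\]
   Context: Fix a field $\mathbb{K}$ and let $S = \mathbb{K}[x_1,\dots,x_n]$, $[n]=\{1,\dots,n\}$. For nonempty $\sigma \subseteq [n]$ let $m_\sigma = \prod_{i\in\sigma} x_i^{\,n-|\sigma|+1}$. For $0 \le k \le n-1$ let $M_n^{(k)} = \langle m_\sigma : \sigma \subseteq [n],\ 1 \le |\sigma| \le k+1\rangle \subset S$. The standard monomials of a monomial ideal are the monomials of $S$ not lying in the ideal. For a weakly increasing sequence of positive integers $\mathbf{u} = (u_1 \le u_2 \le \dots \le u_n)$, a $\mathbf{u}$-parking function is a sequence $(a_1,\dots,a_n)$ of nonnegative integers whose weakly increasing rearrangement $c_1 \le c_2 \le \dots \le c_n$ satisfies $c_j < u_j$ for all $1 \le j \le n$. The set of $\mathbf{u}$-parking functions is denoted $\mathcal{P}(\mathbf{u})$. *)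

(* Defs.v *)
From mathcomp Require Import all_boot all_order all_algebra.
From mathcomp Require Import mpoly.

Set Implicit Arguments.
Unset Strict Implicit.
Unset Printing Implicit Defensive.

Import GRing.Theory.
Local Open Scope ring_scope.

(* Membership of x in the ideal of R generated by the set G: x is a finite    *)
(* sum of terms c.1 * c.2 with c.1 arbitrary and c.2 in G.                    *)
Definition ideal_gen (R : comNzRingType) (G : R -> Prop) (x : R) : Prop :=
  exists s : seq (R * R),
    (forall c, c \in s -> G c.2) /\ x = \sum_(c <- s) c.1 * c.2.

(* The variables x_1, ..., x_n are indexed by 'I_n, in the role of [n]. *)
Definition m_sigma (K : fieldType) (n : nat) (sigma : {set 'I_n}) :
    {mpoly K[n]} :=
  \prod_(i in sigma) 'X_i ^+ (n - #|sigma| + 1).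

Definition M_ideal (K : fieldType) (n k : nat) : {mpoly K[n]} -> Prop :=
  ideal_gen (fun g => exists sigma : {set 'I_n},
    (1 <= #|sigma| <= k + 1)%N /\ g = m_sigma K sigma).

(* A monomial is identified with its exponent vector m : 'X_{1..n}. *)
Definition standard_monomial (K : fieldType) (n : nat)
    (I : {mpoly K[n]} -> Prop) (m : 'X_{1..n}) : Prop :=
  ~ I 'X_[K, m].

Local Open Scope nat_scope.

(* Sequences are indexed from 0. The notion is meant for u weakly increasing  *)
(* with positive entries; u_seq_sorted and u_seq_gt0 below check this for     *)
(* u_seq.                                                                     *)
Definition parking_function (u a : seq nat) : Prop :=
  size a = size u /\
  forall j, j < size u -> nth 0 (sort leq a) j < nth 0 u j.

Definition u_seq (n k : nat) : seq nat :=
  nseq (n - k) (n - k) ++ iota (n - k + 1) k.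

Lemma size_u_seq n k : k <= n -> size (u_seq n k) = n.
Proof. by move=> le_kn; rewrite size_cat size_nseq size_iota subnK. Qed.

Lemma u_seq_sorted n k : sorted leq (u_seq n k).
Proof.
rewrite (sorted_pairwise leq_trans) pairwise_cat; apply/and3P; split.
- apply/allrelP => x y /nseqP[-> _]; rewrite mem_iota addn1 => /andP[+ _].
  exact: ltnW.
- by rewrite -(sorted_pairwise leq_trans); elim: (n - k) {2}(n - k) => [|[|p] IH] // x;
    rewrite /= leqnn; apply: IH.
- by rewrite -(sorted_pairwise leq_trans) iota_sorted.
Qed.

Lemma u_seq_gt0 n k : k < n -> all (leq 1) (u_seq n k).
Proof.
move=> lt_kn; rewrite all_cat; apply/andP; split; apply/allP => x.
  by move=> /nseqP[-> _]; rewrite subn_gt0.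
by rewrite mem_iota addn1 => /andP[+ _]; apply: leq_ltn_trans.
Qed.

(* Main.v *)
Require Import Defs.
From mathcomp Require Import all_boot all_order all_algebra.
From mathcomp Require Import mpoly.
From mathcomp Require Import zify.

(** A monomial lies in a monomial ideal iff a generator divides it, so [m] is
    standard iff for each [1 <= s <= k+1] fewer than [s] exponents of [m] are
    at least [n-s+1]. With [j = n-s], this says that the [j]-th smallest
    exponent (counted from 0) is at most [j], for [n-k-1 <= j < n]; since the
    first [n-k] entries of [u_seq n k] are equal, these are the only conditions
    that matter for a parking function. *)

(** The support of a sum lies in the union of the supports of its terms, and the support of [c.1 *
    'X_[a]] is that of [c.1] shifted by [a], so some [a] divides [m]. *)
Lemma ideal_gen_monomialP (K : fieldType) (n : nat) (G : 'X_{1..n} -> Prop)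
    (m : 'X_{1..n}) :
  ideal_gen (fun g : {mpoly K[n]} => exists2 a, G a & g = 'X_[a]%R) 'X_[m]%R
  <-> exists2 a, G a & (a <= m)%MM.
Proof.
split=> [[s [Gs def_m]] | [a Ga le_am]].
- have : m \in msupp (\sum_(c <- s) c.1 * c.2)%R by rewrite -def_m msuppX mem_head.
  move/msupp_sum_le/flatten_mapP => [c]; rewrite filter_predT => /Gs[a Ga ->].
  by rewrite (perm_mem (msuppMX _ _)) => /mapP[b _ ->]; exists a => //; apply: lem_addr.
- exists [:: ('X_[m - a], 'X_[a])%R]; split=> [c | ].
    by rewrite inE => /eqP->; exists a.
  by rewrite big_seq1 -mpolyXD submK.
Qed.

Lemma m_sigmaE (K : fieldType) (n : nat) (sigma : {set 'I_n}) :
  m_sigma K sigma = 'X_[[multinom (i \in sigma) * (n - #|sigma| + 1) | i < n]]%R.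
Proof.
rewrite [RHS]mpolyXE_id /m_sigma big_mkcond; apply: eq_bigr => i _.
by rewrite mnmE; case: (i \in sigma); rewrite ?mul1n ?mul0n.
Qed.

Lemma M_idealP (K : fieldType) (n k : nat) (m : 'X_{1..n}) :
  M_ideal k 'X_[K, m]%R <->
  exists2 sigma : {set 'I_n}, (1 <= #|sigma| <= k + 1)%N
    & forall i, i \in sigma -> (n - #|sigma| + 1 <= m i)%N.
Proof.
pose a (sigma : {set 'I_n}) : 'X_{1..n} :=
  [multinom (i \in sigma) * (n - #|sigma| + 1) | i < n].
have le_a sigma : (a sigma <= m)%MM <->
    forall i, i \in sigma -> (n - #|sigma| + 1 <= m i)%N.
  split=> [/mnm_lepP le_am i si | le_am].
    by have := le_am i; rewrite mnmE si mul1n.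
  by apply/mnm_lepP => i; rewrite mnmE; case: (boolP (i \in sigma)) => [/le_am|];
    rewrite ?mul1n.
pose G b := exists2 sigma : {set 'I_n}, (1 <= #|sigma| <= k + 1)%N & b = a sigma.
have GE : M_ideal k 'X_[K, m]%R <->
    ideal_gen (fun g : {mpoly K[n]} => exists2 b, G b & g = 'X_[b]%R) 'X_[m]%R.
  split=> -[s [Gs def_m]]; exists s; split=> // c /Gs.
  - case=> sigma [card_s ->]; exists (a sigma); last exact: m_sigmaE.
    by exists sigma.
  - by case=> _ [sigma card_s ->] ->; exists sigma; rewrite m_sigmaE.
split=> [/GE/ideal_gen_monomialP[_ [sigma card_s ->]] /le_a | [sigma card_s le_m]].
  by exists sigma.
by apply/GE/ideal_gen_monomialP; exists (a sigma); [exists sigma | apply/le_a].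
Qed.

Lemma standard_M_idealP (K : fieldType) (n k : nat) (m : 'X_{1..n}) :
  standard_monomial (@M_ideal K n k) m <->
  forall s, (1 <= s <= k + 1)%N -> (#|[set i | n - s + 1 <= m i]| < s)%N.
Proof.
split=> [std s s_k | few /M_idealP[sigma /few + le_m]].
(* With at least [s] large exponents, the binomial number of [s]-subsets of their indices is
   positive; any such subset is a [sigma] contradicting [std]. *)
- rewrite ltnNge; apply/negP; rewrite -bin_gt0 -cards_draws card_gt0.
  case/set0Pn => sigma; rewrite inE => /andP[/subsetP sub_s /eqP card_s].
  apply/std/M_idealP; exists sigma; rewrite card_s // => i /sub_s.
  by rewrite inE.
- rewrite ltnNge => /negP; apply; apply/subset_leq_card/subsetP => i /le_m.
  by rewrite inE.
Qed.

(** After sorting, the entries below [v] form a prefix, so the one at index [j] is below [v] exactly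
    when this prefix has more than [j] entries. *)
Lemma nth_sort_ltn (s : seq nat) (v j : nat) : (j < size s)%N ->
  (nth 0 (sort leq s) j < v)%N = (count (leq v) s < size s - j)%N.
Proof.
move=> lt_js.
have sorted_s : sorted <=%O (sort leq s) by apply: sort_sorted leq_total _.
have cnt : (count (leq v) s + count (< v)%O (sort leq s) = size s)%N.
  rewrite count_sort -(count_predC (leq v) s); congr (_ + _)%N.
  by apply: eq_count => x /=; rewrite -ltnNge.
case: (ltnP (count _ _)) => [few | many].
  suff : (nth 0 (sort leq s) j < v)%O by [].
  by apply: Order.POrderTheory.nth_count_lt => //; lia.
apply/negbTE; rewrite -leqNgt.
suff : (v <= nth 0 (sort leq s) j)%O by [].
apply: Order.TotalTheory.DualTotalTheory.nth_count_ge => //.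
rewrite size_sort lt_js andbT -(leq_add2l (count (leq v) s)) cnt; lia.
Qed.

Lemma count_multinom (n : nat) (p : pred nat) (m : 'X_{1..n}) :
  count p m = #|[set i | p (m i)]|.
Proof.
rewrite -[X in count p X]map_tnth_enum count_map cardsE cardE size_filter enumT.
by apply: eq_count => i.
Qed.

Lemma nth_u_seq (n k j : nat) : (k < n)%N -> (j < n)%N ->
  nth 0 (u_seq n k) j = maxn (n - k) j.+1.
Proof.
move=> lt_kn lt_jn; rewrite nth_cat size_nseq nth_nseq.
case: ltnP => [|le_j]; last rewrite nth_iota; lia.
Qed.

Theorem lemma2p1 (K : fieldType) (n k : nat) (hn : (1 <= n)%N)
    (hk : (0 <= k <= n - 1)%N) (m : 'X_{1..n}) :
  standard_monomial (@M_ideal K n k) m <-> parking_function (u_seq n k) m.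
Proof.
have lt_kn : (k < n)%N by lia.
have lt_nth v j : (j < n)%N -> (nth 0 (sort leq m) j < v)%N =
    (#|[set i | v <= m i]| < n - j)%N.
  by move=> lt_jn; rewrite nth_sort_ltn ?size_tuple // count_multinom.
rewrite standard_M_idealP /parking_function size_tuple (size_u_seq (ltnW lt_kn)).
split=> [few | [_ park] s s_k].
- split=> // j lt_jn; rewrite nth_u_seq // lt_nth //.
  (* For [j >= n - k - 1] this takes [s = n - j]; for smaller [j], [s] is capped at [k + 1], where
     the threshold [n - s + 1] is the constant [n - k] of the first block. *)
  have /few : (1 <= minn (n - j) (k + 1) <= k + 1)%N by lia.
  have -> : (n - minn (n - j) (k + 1) + 1 = maxn (n - k) j.+1)%N by lia.
  by move/leq_trans; apply; apply: geq_minl.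
(* Condition [s] is read off at index [n - s]; as [s <= k + 1], the maximum there is [n - s + 1]. *)
- have lt_jn : (n - s < n)%N by lia.
  have := park _ lt_jn; rewrite nth_u_seq // lt_nth //.
  have -> : (maxn (n - k) (n - s).+1 = n - s + 1)%N by lia.
  by rewrite subKn //; lia.
Qed.
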